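(* Let $p,q,n$ be non-negative integers and let $\alpha_{(p,q;n)}$ be the number of domino tilings of the expanded $(p,q)$-Aztec diamond $AD_{(p,q;n)}$ of order $n$. Define matrices $A_k$ (of size $2^{k-1}\times 2^k$, for $k\ge 1$) by the seed matrices $$A_1=\begin{bmatrix}0&1\end{bmatrix},\qquad A_2=\begin{bmatrix}1&0&0&1\\0&1&0&0\end{bmatrix},$$ and, for $k\ge 3$, the block recurrence $$A_k=\begin{bmatrix}\begin{bmatrix}A_{k-2}&\mathbb{O}\\ \mathbb{O}&\mathbb{O}\end{bmatrix} & A_{k-1}\\ A_{k-1} & \mathbb{O}\end{bmatrix},$$ and define matrices $C_k$ (of size $2^k\times 2^k$, for $k\ge 0$) by $$C_0=\begin{bmatrix}1\end{bmatrix},\qquad C_1=\begin{bmatrix}0&1\\1&0\end{bmatrix},\qquad C_k=\begin{bmatrix}\begin{bmatrix}C_{k-2}&\mathbb{O}\\ \mathbb{O}&\mathbb{O}\end{bmatrix} & C_{k-1}\\ C_{k-1} & \mathbb{O}\end{bmatrix}\ (k\ge 2).$$ For $k=1,\dots,n$ let $$L_{p+2k}=\begin{bmatrix}\begin{bmatrix}A_{p+2k-2}&\mathbb{O}\\ \mathbb{O}&\mathbb{O}\end{bmatrix} & A_{p+2k-1}\end{bmatrix},$$ where, in the single case $p=0$, $k=1$ (where $A_0$ is undefined), the block $\begin{bmatrix}A_{0}&\mathbb{O}\\ \mathbb{O}&\mathbb{O}\end{bmatrix}$ is replaced by $\begin{bmatrix}1&0\end{bmatrix}$. Then $\alpha_{(p,q;n)}$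 equals the $(1,1)$-entry of the $2^p\times 2^p$ matrix $$\Big(\prod_{k=1}^n L_{p+2k}\Big)\cdot \big(C_{p+2n}\big)^q\cdot \Big(\prod_{k=1}^n L_{p+2k}\Big)^t ,$$ where $\prod_{k=1}^n L_{p+2k}=L_{p+2}L_{p+4}\cdots L_{p+2n}$.
   Context: $\mathbb{O}$ denotes a zero matrix of the appropriate size and $X^t$ the transpose of $X$. The expanded $(p,q)$-Aztec diamond of order $n$, $AD_{(p,q;n)}$, is the union of $2n(n+p+q+1)+pq$ unit lattice squares arranged as a bilaterally symmetric stack of $2n+q$ rows: for $j=1,\dots,2n+q$, row $j$ is $[-\ell_j/2,\ell_j/2]\times[j-1,j]$ subdivided into unit squares, where $\ell_j=p+2j$ for $1\le j\le n$, $\ell_j=p+2n$ for $n<j\le n+q$, and $\ell_j=p+2(2n+q+1-j)$ for $n+q<j\le 2n+q$ (so the row lengths are $p+2,p+4,\dots,p+2n,\dots,p+2n,\dots,p+4,p+2$). A domino tiling is a partition of the region into $1\times 2$ or $2\times 1$ rectangles each consisting of two of its unit squares. *)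

(* Defs.v *)
From HB Require Import structures.
From mathcomp Require Import all_boot all_order all_algebra.
Set Implicit Arguments.
Unset Strict Implicit.
Unset Printing Implicit Defensive.
Import GRing.Theory.

(** * The region and its domino tilings *)

(* Length of row [j], with [1 <= j <= 2n + q]. *)
Definition row_length (p q n j : nat) : nat :=
  if j <= n then p + j.*2
  else if j <= n + q then p + n.*2
  else p + (n.*2 + q + 1 - j).*2.

(* The pair [(c, r)] stands for the unit square
   [[c - w/2, c + 1 - w/2] x [r, r + 1]] with [w = p + 2n], which would lie in
   row [j = r + 1]; these squares fill the bounding box of the region. *)
Definition square (p q n : nat) := ('I_(p + n.*2) * 'I_(n.*2 + q))%type.

(* With [l] the length of row [r + 1], the two conditions are
   [- l/2 <= c - w/2] and [c + 1 - w/2 <= l/2], multiplied by 2. *)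
Definition aztec (p q n : nat) : {set square p q n} :=
  [set x : square p q n | let l := row_length p q n x.2.+1 in
           (p + n.*2 <= l + x.1.*2) && (x.1.+1.*2 <= l + (p + n.*2))].

Definition horizontal (p q n : nat) (x y : square p q n) : bool :=
  (x.2 == y.2 :> nat) && (y.1 == x.1.+1 :> nat).

Definition vertical (p q n : nat) (x y : square p q n) : bool :=
  (x.1 == y.1 :> nat) && (y.2 == x.2.+1 :> nat).

Definition is_domino (p q n : nat) (B : {set square p q n}) : bool :=
  [exists x, exists y, (horizontal x y || vertical x y) && (B == [set x; y])].

Definition domino_tilings (p q n : nat) : {set {set {set square p q n}}} :=
  [set P | partition P (aztec p q n) && [forall B in P, is_domino B]].

Definition alpha (p q n : nat) : nat := #|domino_tilings p q n|.

(** * The matrices *)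

(* [2 ^ k], in a form for which [pow2 k.+1] is convertible to
   [pow2 k + pow2 k], so that block matrices typecheck without casts. *)
Fixpoint pow2 (k : nat) : nat := if k is k'.+1 then pow2 k' + pow2 k' else 1.

Lemma pow2E k : pow2 k = 2 ^ k.
Proof. by elim: k => //= k ->; rewrite expnS mul2n addnn. Qed.

Lemma pow2_gt0 k : 0 < pow2 k.
Proof. by rewrite pow2E expn_gt0. Qed.

(* The first row (or column) index. *)
Definition idx1 (k : nat) : 'I_(pow2 k) := Ordinal (pow2_gt0 k).

Definition mx_of_rows (m n : nat) (s : seq (seq nat)) : 'M[nat]_(m, n) :=
  \matrix_(i, j) nth 0 (nth [::] s i) j.

Local Open Scope ring_scope.

Definition pad (m n : nat) (M : 'M[nat]_(m, n)) : 'M[nat]_(m + m, n + n) :=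
  block_mx M 0 0 0.

(* The pair [(A_{k+1}, A_{k+2})]. *)
Fixpoint A_pair (k : nat) :
    'M[nat]_(pow2 k, pow2 k.+1) * 'M[nat]_(pow2 k.+1, pow2 k.+2) :=
  if k is k'.+1 then
    let: (A1, A2) := A_pair k' in (A2, block_mx (pad A1) A2 A2 0)
  else (mx_of_rows _ _ [:: [:: 0; 1]],
        mx_of_rows _ _ [:: [:: 1; 0; 0; 1]; [:: 0; 1; 0; 0]])%N.

(* Only meaningful for [k >= 1]. *)
Definition A (k : nat) : 'M[nat]_(pow2 k.-1, pow2 k) :=
  if k is k'.+1 then (A_pair k').1 else 0.

Lemma A_1 : A 1 = mx_of_rows _ _ [:: [:: 0; 1]]%N.
Proof. by []. Qed.

Lemma A_2 : A 2 = mx_of_rows _ _ [:: [:: 1; 0; 0; 1]; [:: 0; 1; 0; 0]]%N.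
Proof. by []. Qed.

Lemma A_rec k : A k.+3 = block_mx (pad (A k.+1)) (A k.+2) (A k.+2) 0.
Proof. by rewrite /A /=; case: (A_pair k). Qed.

(* The pair [(C_k, C_{k+1})]. *)
Fixpoint C_pair (k : nat) : 'M[nat]_(pow2 k) * 'M[nat]_(pow2 k.+1) :=
  if k is k'.+1 then
    let: (C0, C1) := C_pair k' in (C1, block_mx (pad C0) C1 C1 0)
  else (mx_of_rows _ _ [:: [:: 1]],
        mx_of_rows _ _ [:: [:: 0; 1]; [:: 1; 0]])%N.

Definition C (k : nat) : 'M[nat]_(pow2 k) := (C_pair k).1.

Lemma C_0 : C 0 = mx_of_rows _ _ [:: [:: 1]]%N.
Proof. by []. Qed.

Lemma C_1 : C 1 = mx_of_rows _ _ [:: [:: 0; 1]; [:: 1; 0]]%N.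
Proof. by []. Qed.

Lemma C_rec k : C k.+2 = block_mx (pad (C k)) (C k.+1) (C k.+1) 0.
Proof. by rewrite /C /=; case: (C_pair k). Qed.

(* Only meaningful for [m >= 2]; [L 2] is the exceptional case, where [A_0]
   would be needed. *)
Definition L (m : nat) : 'M[nat]_(pow2 m.-2, pow2 m) :=
  match m with
  | 0 | 1 => 0
  | 2 => row_mx (mx_of_rows 1 2 [:: [:: 1; 0]]%N) (A 1)
  | m'.+3 => row_mx (pad (A m'.+1)) (A m'.+2)
  end.

(* [L_{p+2} *m L_{p+4} *m ... *m L_{p+2n}]; writing [n.*2 + p] rather than
   [p + n.*2] makes the dimensions of consecutive factors convertible. *)
Fixpoint L_prod (p n : nat) : 'M[nat]_(pow2 p, pow2 (n.*2 + p)) :=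
  match n return 'M[nat]_(pow2 p, pow2 (n.*2 + p)) with
  | 0 => 1%:M
  | n'.+1 => L_prod p n' *m L (n'.+1.*2 + p)
  end.

(* Main.v *)
(** Cut the diamond along its horizontal row boundaries and record, for each
    boundary, in which columns a vertical domino crosses it.  Scanning a row from
    left to right, its first free cell is covered either by a horizontal domino
    or by a vertical one going up; this is exactly the block recurrence of the
    matrices, so [C k] is the transfer matrix of a row of length [k] between two
    boundaries of the same width, [L m] that of a row whose two outer cells have
    nothing below them, [A k] the intermediate case of a row whose last cell has
    nothing below it, and [L m]^T that of a row whose outer cells have nothing
    above them.  The product of the transfer matrices counts the tilings. *)
Require Import Defs.
From HB Require Import structures.
From mathcomp Require Import all_boot all_order all_algebra.
From mathcomp Require Import zify.
Set Implicit Arguments.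
Unset Strict Implicit.
Unset Printing Implicit Defensive.
Import GRing.Theory.
Local Open Scope ring_scope.

(** * Counting tilings by the tile over a given point *)

Section Tilings.

Variables (T : finType) (tile : pred {set T}).

Definition tilings (S : {set T}) : {set {set {set T}}} :=
  [set P | partition P S && [forall B in P, tile B]].

Lemma card_tilings0 : #|tilings set0| = 1%N.
Proof.
suff -> : tilings set0 = [set set0] by rewrite cards1.
apply/setP => P; rewrite !inE partition_set0.
case: eqP => // ->; apply/forall_inP => B; by rewrite inE.
Qed.

(** Each tiling has one block [B] over [x]; deleting [B] is a bijection onto the tilings of
    [S :\: B], with inverse [B |: P]. *)
Lemma card_tilings_rec (S : {set T}) (x : T) : x \in S ->
  #|tilings S| =
  (\sum_(B | [&& tile B, x \in B & B \subset S]) #|tilings (S :\: B)|)%N.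
Proof.
move=> Sx; rewrite -sum1_card.
rewrite (partition_big (fun P => pblock P x)
  (fun B => [&& tile B, x \in B & B \subset S])) /=; last first.
  move=> P; rewrite inE => /andP[partP /forall_inP tileP].
  have Px : x \in cover P by rewrite (cover_partition partP).
  by rewrite tileP ?pblock_mem // mem_pblock Px (partitionS partP) ?pblock_mem.
apply: eq_bigr => B /and3P[tileB Bx sBS].
have B0 : B != set0 by apply/set0Pn; exists x.
have dB : [disjoint B & S :\: B].
  by rewrite -setI_eq0 setIDA setDIl setDv set0I.
have notB P : P \in tilings (S :\: B) -> B \notin P.
  rewrite inE => /andP[partP _]; apply/negP => BP.
  have := subsetP (partitionS partP BP) _ Bx.
  by rewrite inE Bx.
rewrite sum1_card.
rewrite -(@card_in_imset _ _ (fun P => B |: P) (tilings (S :\: B))); last first.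
  by move=> P Q PS QS eqPQ; rewrite -(setU1K (notB P PS)) eqPQ setU1K ?notB.
apply: eq_card => P; rewrite -topredE /=; apply/andP/imsetP.
  rewrite inE => -[/andP[partP /forall_inP tileP] /eqP eqB].
  have PB : B \in P by rewrite -eqB pblock_mem // (cover_partition partP).
  exists (P :\ B); last by rewrite setD1K.
  rewrite inE partitionD1 //; apply/forall_inP => B' /setD1P[_]; exact: tileP.
case=> Q QS ->; move: (QS); rewrite !inE => /andP[partQ /forall_inP tileQ].
have partU : partition (B |: Q) S.
  by rewrite -(setID S B) (setIidPr sBS) partitionU1.
rewrite partU; split; last first.
  by apply/eqP; apply: def_pblock (partition_trivIset partU) _ Bx; rewrite setU11.
by apply/forall_inP => B' /setU1P[-> //|]; exact: tileQ.
Qed.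

End Tilings.

(** * Boundary states as matrix indices *)

(* A state of a row boundary is read from left to right, the bit [true] marking
   the columns in which a vertical domino crosses the boundary.  The leftmost
   column is the most significant bit of the matrix index. *)
Fixpoint bits (k : nat) : 'I_(pow2 k) -> seq bool :=
  match k with
  | 0 => fun _ => [::]
  | k'.+1 => fun i => match split i with
                      | inl j => false :: bits j
                      | inr j => true :: bits j
                      end
  end.

Lemma bits_lshift k (i : 'I_(pow2 k)) :
  @bits k.+1 (lshift (pow2 k) i) = false :: bits i.
Proof. by rewrite /= (unsplitK (inl i)). Qed.

Lemma bits_rshift k (i : 'I_(pow2 k)) :
  @bits k.+1 (rshift (pow2 k) i) = true :: bits i.
Proof. by rewrite /= (unsplitK (inr i)). Qed.

Lemma size_bits k (i : 'I_(pow2 k)) : size (bits i) = k.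
Proof. by elim: k i => //= k IHk i; case: (split i) => j /=; rewrite IHk. Qed.

Lemma bits_idx1 k : bits (idx1 k) = nseq k false.
Proof.
elim: k => //= k IHk; case: (split_ordP (idx1 k.+1)) => j.
  by move/(congr1 val) => /= j0; rewrite -IHk; congr (_ :: bits _); apply: val_inj.
move/(congr1 val)/eqP; rewrite /= eq_sym addn_eq0 => /andP[pk0 _].
by have := pow2_gt0 k; rewrite lt0n pk0.
Qed.

Lemma has_bits k (i : 'I_(pow2 k)) : has id (bits i) = (i != idx1 k).
Proof.
elim: k i => [|k IHk] i; first by rewrite [i]ord1 [idx1 0]ord1 eqxx.
case: (split_ordP i) => j ->; first by rewrite bits_lshift /= IHk.
rewrite bits_rshift /= -val_eqE /= addn_eq0 negb_and -lt0n.
by rewrite (pow2_gt0 k).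
Qed.

Lemma big_pow2S k (F : 'I_(pow2 k.+1) -> nat) :
  (\sum_i F i = \sum_(i < pow2 k) F (lshift (pow2 k) i) +
                \sum_(i < pow2 k) F (rshift (pow2 k) i))%N.
Proof. exact: big_split_ord. Qed.

(** For a boundary whose last column has no cell above it. [pow2] splits off the leading bit, so the
    trailing one is reached by induction. *)
Lemma big_bits_rcons k (F : seq bool -> nat) :
    (forall s, size s = k -> F (rcons s true) = 0%N) ->
  (\sum_(i < pow2 k.+1) F (bits i) =
   \sum_(i < pow2 k) F (rcons (bits i) false))%N.
Proof.
elim: k F => [|k IHk] F F0.
  rewrite big_pow2S !big_ord1 bits_lshift bits_rshift.
  by rewrite [X in (_ + X)%N](F0 [::]) // addn0.
rewrite big_pow2S [RHS]big_pow2S; congr (_ + _)%N.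
  under eq_bigr do rewrite bits_lshift.
  under [RHS]eq_bigr do rewrite bits_lshift.
  by apply: (IHk (fun s => F (false :: s))) => s sk; rewrite -rcons_cons F0 //= sk.
under eq_bigr do rewrite bits_rshift.
under [RHS]eq_bigr do rewrite bits_rshift.
by apply: (IHk (fun s => F (true :: s))) => s sk; rewrite -rcons_cons F0 //= sk.
Qed.

(** * Matrix entries as numbers of row fillings *)

(* The number of ways to fill a row by horizontal dominoes when vertical
   dominoes cross its lower boundary as told by [s] and its upper boundary as
   told by [t]. *)
Fixpoint trans (s t : seq bool) : nat :=
  match s, t with
  | [::], [::] => 1
  | true :: s', false :: t' => trans s' t'
  | false :: s', true :: t' => trans s' t'
  | false :: s', false :: t' =>
      match s', t' with
      | false :: s'', false :: t'' => trans s'' t''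
      | _, _ => 0
      end
  | _, _ => 0
  end.

(** The clauses of [trans] are symmetric; the induction bounds the size because one clause removes
    two bits. *)
Lemma transC s t : trans s t = trans t s.
Proof.
have [k] := ubnP (size s); elim: k s t => // k IHk.
case=> [|[] s] [|[] t] //=; rewrite ltnS => sk; try exact: IHk.
case: s t sk => [|[] s] [|[] t] //= sk; apply: IHk; lia.
Qed.

(** Splitting the indices reads the leading bits. In the upper left block both are [false], so a
    horizontal domino forces the next two to be [false]: this is [pad]. *)
Lemma CE k (i j : 'I_(pow2 k)) : C k i j = trans (bits i) (bits j).
Proof.
have [m] := ubnP k; elim: m k i j => // m IHm [|[|k]] i j; rewrite ?ltnS => km.
- by rewrite C_0 mxE !ord1.
- rewrite C_1 mxE.
  by case: (split_ordP i) => i' ->; case: (split_ordP j) => j' ->;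
    rewrite ?bits_lshift ?bits_rshift !ord1.
rewrite C_rec.
case: (split_ordP i) => {}i ->; case: (split_ordP j) => {}j ->.
- rewrite block_mxEul !bits_lshift /pad.
  case: (split_ordP i) => {}i ->; case: (split_ordP j) => {}j ->.
  + by rewrite block_mxEul !bits_lshift; exact: (IHm k i j (ltn_trans (ltnSn k) km)).
  + by rewrite block_mxEur bits_lshift bits_rshift mxE.
  + by rewrite block_mxEdl bits_lshift bits_rshift mxE.
  + by rewrite block_mxEdr !bits_rshift mxE.
- by rewrite block_mxEur bits_lshift bits_rshift; exact: (IHm k.+1 i j km).
- by rewrite block_mxEdl bits_lshift bits_rshift; exact: (IHm k.+1 i j km).
- by rewrite block_mxEdr !bits_rshift mxE.
Qed.

(** The last cell, with nothing below it, gets the bit [false]; the recurrence is that of [C]. *)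
Lemma AE k (i : 'I_(pow2 k)) (j : 'I_(pow2 k.+1)) :
  A k.+1 i j = trans (rcons (bits i) false) (bits j).
Proof.
have [m] := ubnP k; elim: m k i j => // m IHm [|[|k]] i j; rewrite ?ltnS => km.
- rewrite A_1 mxE.
  by case: (split_ordP j) => j' ->; rewrite ?bits_lshift ?bits_rshift !ord1.
- rewrite A_2 mxE.
  by case: (split_ordP i) => i' ->; case: (split_ordP j) => j' ->;
    case: (split_ordP j') => j'' ->;
    rewrite ?bits_lshift ?bits_rshift ?bits_lshift ?bits_rshift !ord1.
rewrite A_rec.
case: (split_ordP i) => {}i ->; case: (split_ordP j) => {}j ->.
- rewrite block_mxEul !bits_lshift /pad.
  case: (split_ordP i) => {}i ->; case: (split_ordP j) => {}j ->.
  + by rewrite block_mxEul !bits_lshift; exact: (IHm k i j (ltn_trans (ltnSn k) km)).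
  + by rewrite block_mxEur bits_lshift bits_rshift mxE.
  + by rewrite block_mxEdl bits_lshift bits_rshift mxE.
  + by rewrite block_mxEdr !bits_rshift mxE.
- by rewrite block_mxEur bits_lshift bits_rshift; exact: (IHm k.+1 i j km).
- by rewrite block_mxEdl bits_lshift bits_rshift; exact: (IHm k.+1 i j km).
- by rewrite block_mxEdr !bits_rshift mxE.
Qed.

(** [L m.+2] is the upper half of [A m.+2], whose row states start with [false]; this also explains
    the exceptional block in [L 2]. *)
Lemma LE m (i : 'I_(pow2 m)) (j : 'I_(pow2 m.+2)) :
  L m.+2 i j = trans (false :: rcons (bits i) false) (bits j).
Proof.
case: m i j => [|m] i j; rewrite /L.
  case: (split_ordP j) => {}j ->; last by rewrite row_mxEr bits_rshift; exact: (@AE _ i j).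
  rewrite row_mxEl bits_lshift mxE.
  by case: (split_ordP j) => {}j ->; rewrite ?bits_lshift ?bits_rshift !ord1.
case: (split_ordP j) => {}j ->; last by rewrite row_mxEr bits_rshift; exact: (@AE _ i j).
rewrite row_mxEl bits_lshift /pad.
case: (split_ordP i) => {}i ->; case: (split_ordP j) => {}j ->.
- by rewrite block_mxEul !bits_lshift; exact: (@AE _ i j).
- by rewrite block_mxEur bits_lshift bits_rshift mxE.
- by rewrite block_mxEdl bits_lshift bits_rshift mxE.
- by rewrite block_mxEdr !bits_rshift mxE.
Qed.

(** * Scanning the cells of a region *)

Section Geometry.

Variables (p q n : nat).
Local Notation sq := (square p q n).
Implicit Types (X : {set sq}) (x y : sq).

Definition ntil X : nat := #|tilings (@is_domino p q n) X|.

Definition at_cell (c r : nat) x : bool := (x.1 == c :> nat) && (x.2 == r :> nat).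

Lemma at_cell_inj c r x y : at_cell c r x -> at_cell c r y -> x = y.
Proof.
case: x y => [x1 x2] [y1 y2] /andP[/= /eqP xc /eqP xr] /andP[/= /eqP yc /eqP yr].
by congr (_, _); apply: val_inj => /=; rewrite ?xc ?xr ?yc ?yr.
Qed.

Lemma big_at_cell c r X x (F : sq -> nat) : at_cell c r x -> x \in X ->
  (\sum_(y in X | at_cell c r y) F y)%N = F x.
Proof.
move=> cx Xx; rewrite (big_pred1 x) // => y /=; apply/andP/eqP => [[_ cy]|-> //].
exact: at_cell_inj cy cx.
Qed.

(** As [x] is the leftmost cell of the lowest row, its domino can only extend to the right or
    upwards. *)
Lemma ntil_scan X c r x : x \in X -> at_cell c r x ->
    (forall y, y \in X -> (r <= y.2)%N) ->
    (forall y, y \in X -> y.2 = r :> nat -> (c <= y.1)%N) ->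
  ntil X =
  (\sum_(y in X | at_cell c.+1 r y) ntil (X :\ x :\ y) +
   \sum_(y in X | at_cell c r.+1 y) ntil (X :\ x :\ y))%N.
Proof.
move=> Xx /andP[/eqP xc /eqP xr] Xr Xc.
pose Y := [set y in X | at_cell c.+1 r y || at_cell c r.+1 y].
have xY : x \notin Y.
  rewrite inE /at_cell xc xr (ltn_eqF (ltnSn c)) (ltn_eqF (ltnSn r)).
  by rewrite !andbF.
rewrite /ntil (card_tilings_rec _ Xx).
transitivity (\sum_(B in [set [set x; y] | y in Y]) ntil (X :\: B))%N.
  apply: eq_bigl => B; apply/and3P/imsetP => [[]|[y]].
    case/existsP => u /existsP[v /andP[uv /eqP ->]] xuv /subsetP sX.
    have Xu : u \in X by rewrite sX // set21.
    have Xv : v \in X by rewrite sX // set22.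
    (* If [x] were the second cell of the domino, the first would lie to its left or below it,
       outside [X]. *)
    case/set2P: xuv uv => <- /orP[] /andP[/eqP e1 /eqP e2].
    - by exists v => //; rewrite inE Xv /at_cell e2 -e1 xc xr !eqxx.
    - by exists v => //; rewrite inE Xv /at_cell e2 -e1 xc xr !eqxx orbT.
    - by have := Xc _ Xu; rewrite e1 xr => /(_ erefl); rewrite -xc e2 ltnn.
    - by have := Xr _ Xu; rewrite -xr e2 ltnn.
  rewrite inE => /andP[Xy xy] ->; split.
  - apply/existsP; exists x; apply/existsP; exists y; rewrite eqxx andbT.
    rewrite /horizontal /vertical xc xr.
    by case/orP: xy => /andP[/eqP-> /eqP->]; rewrite !eqxx ?orbT.
  - exact: set21.
  - by apply/subsetP => z /set2P[] ->.
rewrite big_imset /=; last first.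
  move=> y z yY zY eqyz; have : y \in [set x; z] by rewrite -eqyz set22.
  by case/set2P => // yx; move: xY; rewrite -yx yY.
under eq_bigr do rewrite -setDDl.
rewrite (bigID (at_cell c.+1 r)) /=; congr (_ + _)%N; apply: eq_bigl => y.
  by rewrite inE -andbA; case: (at_cell c.+1 r y); rewrite ?andbF.
rewrite inE -andbA; congr (_ && _).
rewrite /at_cell; case: (eqVneq (y.1 : nat) c) => [->|_] /=.
  by rewrite ltn_eqF //= andbT.
by rewrite orbF andbN.
Qed.

(** * Transfer across one row *)

(* The number of tilings of [X] deprived of the cells of row [r] marked by [t],
   read from column [c] on; it is 0 when a marked cell is missing from [X]. *)
Fixpoint ext X (c r : nat) (t : seq bool) : nat :=
  match t with
  | [::] => ntil X
  | false :: t' => ext X c.+1 r t'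
  | true :: t' => (\sum_(y in X | at_cell c r y) ext (X :\ y) c.+1 r t')%N
  end.

(** The default [true] ends the row after [size s] columns. *)
Definition free_cells (c r : nat) (s : seq bool) : {set sq} :=
  [set x : sq | [&& x.2 == r :> nat, (c <= x.1)%N & ~~ nth true s (x.1 - c)]].

Lemma free_cells_nil c r : free_cells c r [::] = set0.
Proof. by apply/setP => x; rewrite !inE nth_nil !andbF. Qed.

Lemma free_cells_true c r s : free_cells c r (true :: s) = free_cells c.+1 r s.
Proof.
apply/setP => x; rewrite !inE; congr (_ && _).
case: ltngtP => [lt_c|//|<-]; last by rewrite subnn.
by rewrite -(subnSK lt_c).
Qed.

Lemma free_cells_false c r s x : at_cell c r x ->
  free_cells c r (false :: s) = x |: free_cells c.+1 r s.
Proof.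
move=> cx; apply/setP => y; rewrite !inE.
have -> : (y == x) = at_cell c r y.
  by apply/eqP/idP => [-> //|cy]; apply: at_cell_inj cx.
rewrite /at_cell; case: (ltngtP c y.1) => [lt_c|lt_c|<-] /=.
- by rewrite -(subnSK lt_c).
- by [].
- by rewrite subnn /= andbF orbF andbT.
Qed.

(** Scan from the left: a vertical domino on the first free cell takes a cell of [X], so [X] must
    vary; a horizontal one uses two columns, hence the strong induction. *)
Lemma row_transfer k s X c r : size s = k ->
    (c + k <= p + n.*2)%N -> (r < n.*2 + q)%N ->
    (forall x, x \in X -> (r < x.2)%N) ->
  ntil (free_cells c r s :|: X) =
  (\sum_(t < pow2 k) trans s (bits t) * ext X c r.+1 (bits t))%N.
Proof.
move=> sk ck rH; have [m] := ubnP k.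
elim: m k s X c sk ck => // m IHm [|k] [|b s] X c //.
  by rewrite free_cells_nil set0U big_ord1 mul1n.
move=> [sk] ck; rewrite ltnS => km Xr.
rewrite big_pow2S.
under eq_bigr do rewrite bits_lshift.
under [Z in _ = (_ + Z)%N]eq_bigr do rewrite bits_rshift.
case: b.
  rewrite free_cells_true [Z in _ = (_ + Z)%N]big1 // addn0.
  by apply: IHm => //; rewrite addSnnS.
have cW : (c < p + n.*2)%N by apply: leq_trans ck; rewrite addnS ltnS leq_addr.
pose x : sq := (Ordinal cW, Ordinal rH).
have cx : at_cell c r x by rewrite /at_cell !eqxx.
have XcN y : y \in X -> y.2 = r :> nat -> False.
  by move=> /Xr + yr; rewrite yr ltnn.
have fx : x \notin free_cells c.+1 r s by rewrite inE /= ltnn andbF.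
have xX : x \notin X by apply/negP => /XcN; apply.
rewrite (free_cells_false _ cx) -setUA (@ntil_scan _ c r x) //; first last.
- move=> y; rewrite !inE => /or3P[/eqP -> //|/and3P[_ /ltnW //]|/XcN yX /yX //].
- move=> y; rewrite !inE => /or3P[/eqP -> //|/and3P[/eqP -> //]|/Xr/ltnW //].
- exact: setU11.
have -> : (x |: (free_cells c.+1 r s :|: X)) :\ x = free_cells c.+1 r s :|: X.
  by rewrite setU1K // inE negb_or fx.
(* Horizontal domino: both sides vanish if the row ends or the next cell is already covered. *)
congr (_ + _)%N.
  case: s sk fx => [|[] s] /= sk fx.
  - rewrite big_pred0 ?big1 // => y; apply/negP; rewrite free_cells_nil set0U.
    case/andP => /setU1P[->|/XcN yX] /andP[]; last by move=> _ /eqP.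
    by rewrite /= ltn_eqF.
  - rewrite big_pred0 ?big1 // => y; apply/negP.
    case/andP => /setU1P[->|]; first by rewrite /at_cell /= ltn_eqF.
    rewrite inE => /orP[|/XcN yX /andP[_ /eqP]] //.
    by rewrite inE => /and3P[_ _ nb] /andP[/eqP yc _]; rewrite yc subnn in nb.
  case: k sk ck km => // k [sk] ck km.
  have c1W : (c.+1 < p + n.*2)%N.
    by apply: leq_trans ck; rewrite !addnS !ltnS leq_addr.
  pose y : sq := (Ordinal c1W, Ordinal rH).
  have cy : at_cell c.+1 r y by rewrite /at_cell !eqxx.
  have fy : y \notin free_cells c.+2 r s by rewrite inE /= ltnn andbF.
  have yX : y \notin X by apply/negP => /XcN; apply.
  rewrite (big_at_cell _ cy); last first.
    by rewrite (free_cells_false _ cy) !inE eqxx orbT.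
  have yN : y \notin free_cells c.+2 r s :|: X by rewrite inE negb_or fy.
  rewrite (free_cells_false _ cy) -setUA (setU1K yN).
  have c2k : (c.+2 + k <= p + n.*2)%N by rewrite !addSn -!addnS.
  rewrite (IHm k) // ?(ltn_trans _ km) //.
  rewrite big_pow2S [Z in _ = (_ + Z)%N]big1 ?addn0.
    by apply: eq_bigr => t _; rewrite bits_lshift.
  by move=> t _; rewrite bits_rshift.
(* Vertical domino: its upper cell [y] is in row [r.+1], hence in [X] and not among the free
   cells. *)
transitivity (\sum_(y in X | at_cell c r.+1 y)
                ntil (free_cells c.+1 r s :|: (X :\ y)))%N.
  apply: eq_big => [y|y /andP[_ /andP[_ /eqP yr]]].
    rewrite !inE; case cy: (at_cell c r.+1 y); rewrite ?andbF // !andbT.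
    case/andP: cy => _ /eqP yr; rewrite yr [_.+1 == r]gtn_eqF //=.
    by case: eqP => // yx; move: yr; rewrite yx /= => /eqP; rewrite ltn_eqF.
  congr ntil; rewrite setDUl; congr (_ :|: _); apply/setDidPl.
  by rewrite disjoint_sym disjoints1 inE yr gtn_eqF.
under eq_bigr => y _.
  rewrite (IHm k) //; [|by rewrite addSnnS|by move=> z /setD1P[_ /Xr]].
  over.
rewrite exchange_big /=; apply: eq_bigr => t _.
by rewrite big_distrr.
Qed.

Lemma ext_nseq_false X c r k : ext X c r (nseq k false) = ntil X.
Proof. by elim: k c => //= k IHk c. Qed.

Lemma ext_rcons_false X c r t : ext X c r (rcons t false) = ext X c r t.
Proof. by elim: t X c => //= -[] t IHt X c //; apply: eq_bigr. Qed.

Lemma ext_rcons_true X c r t :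
    (forall x, x \in X -> ~~ at_cell (c + size t) r x) ->
  ext X c r (rcons t true) = 0%N.
Proof.
elim: t X c => [|[] t IHt] X c X0 /=.
- by rewrite big1 // => x /andP[/X0]; rewrite addn0 => /negbTE ->.
- rewrite big1 // => x _; apply: IHt => y /setD1P[_ /X0].
  by rewrite addSnnS.
- by apply: IHt => y /X0; rewrite addSnnS.
Qed.

Lemma ext_set0 c r t : ext set0 c r t = ~~ has id t.
Proof.
elim: t c => [|[] t IHt] c //=; first exact: card_tilings0.
by rewrite big1 // => x; rewrite inE.
Qed.

(** Unmarked cells already passed are moved into [X], which may therefore meet row [r] left of
    column [c]. *)
Lemma ext_free_cells X c r s :
    (c + size s <= p + n.*2)%N -> (r < n.*2 + q)%N ->
    (forall x, x \in X -> x.2 = r :> nat -> (x.1 < c)%N) ->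
  ext (free_cells c r (nseq (size s) false) :|: X) c r s =
  ntil (free_cells c r s :|: X).
Proof.
elim: s X c => [|b s IHs] X c // cs rH Xc.
have cs1 : (c.+1 + size s <= p + n.*2)%N by rewrite addSnnS.
have cW : (c < p + n.*2)%N by apply: leq_trans cs1; rewrite addSn ltnS leq_addr.
pose x : sq := (Ordinal cW, Ordinal rH).
have cx : at_cell c r x by rewrite /at_cell !eqxx.
rewrite (free_cells_false _ cx) -setUA; case: b {cs} => /=.
  rewrite free_cells_true (big_at_cell _ cx) ?setU11 // setU1K.
    by apply: IHs => // y yX yr; apply: ltnW; apply: Xc.
  rewrite !inE /= ltnn andbF /=; apply/negP => /Xc /= /(_ erefl).
  by rewrite ltnn.
rewrite (free_cells_false _ cx) -setUA setUCA [in RHS]setUCA; apply: IHs => //.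
by move=> y /setU1P[-> //|yX yr]; apply: ltnW; apply: Xc.
Qed.

(** * Rows of the diamond *)

Definition rows_from (r : nat) : {set sq} := [set x in aztec p q n | (r <= x.2)%N].

Lemma mem_rows_from r x :
  (x \in rows_from r) = (x \in aztec p q n) && (r <= x.2)%N.
Proof. by rewrite [LHS]in_set. Qed.

(** Rows are centred, so [c] is the margin on either side of a row of length [l]. *)
Lemma mem_aztec c l x :
    row_length p q n x.2.+1 = l -> (l + c.*2 = p + n.*2)%N ->
  (x \in aztec p q n) = (c <= x.1 < c + l)%N.
Proof.
move=> xl lc; rewrite inE /= xl; move: (x.1 : nat) => a.
by clear -lc; lia.
Qed.

Lemma rows_fromS c r l :
    row_length p q n r.+1 = l -> (l + c.*2 = p + n.*2)%N ->
  rows_from r = free_cells c r (nseq l false) :|: rows_from r.+1.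
Proof.
move=> rl lc; apply/setP => x; rewrite in_setU !mem_rows_from [x \in free_cells _ _ _]in_set.
rewrite nth_nseq eq_sym; case: (ltngtP r x.2) => [||xr] /=; rewrite ?andbF ?andbT //=.
rewrite (@mem_aztec c l) -?xr // orbF.
by case: (leqP c x.1) => //= cx; rewrite ltn_subLR //; case: ifP.
Qed.

Lemma ext_rows_from c r l s :
    size s = l -> (r < n.*2 + q)%N ->
    row_length p q n r.+1 = l -> (l + c.*2 = p + n.*2)%N ->
  ext (rows_from r) c r s =
  (\sum_(t < pow2 l) trans s (bits t) * ext (rows_from r.+1) c r.+1 (bits t))%N.
Proof.
move=> sl rH rl lc; have cs : (c + l <= p + n.*2)%N.
  by rewrite -lc addnC leq_add2l -addnn leq_addr.
rewrite (rows_fromS rl lc) -sl ext_free_cells ?sl //.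
  by apply: row_transfer => // x; rewrite mem_rows_from => /andP[].
by move=> x; rewrite mem_rows_from => /andP[_ xr] xr'; rewrite xr' ltnn in xr.
Qed.

(** * Recurrences for the columns of counts *)

(* The entries of the three kinds of columns count the tilings of the part of
   the diamond above a row boundary, as functions of the state of that boundary.
   [k] is such that the boundary has width [p + 2k]. *)
Definition lower_col k : 'cV[nat]_(pow2 (k.*2 + p)) :=
  \col_i ext (rows_from k) (n - k) k (bits i).

Definition middle_col j : 'cV[nat]_(pow2 (n.*2 + p)) :=
  \col_i ext (rows_from (n + j)) 0 (n + j) (bits i).

Definition upper_col k : 'cV[nat]_(pow2 (k.*2 + p)) :=
  \col_i ext (rows_from (n.*2 + q - k)) (n - k) (n.*2 + q - k) (bits i).

Lemma lower_colS k : (k < n)%N -> lower_col k = L (k.+1.*2 + p) *m lower_col k.+1.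
Proof.
move=> kn; apply/matrixP => i j; rewrite mxE [RHS]mxE.
(* The row exceeds its lower boundary by one column on each side; these get the bit [false]. *)
rewrite -(subnSK kn) -(ext_rcons_false _ _ _ (bits i)).
rewrite -[LHS]/(ext (rows_from k) (n - k.+1) k (false :: rcons (bits i) false)).
rewrite (@ext_rows_from _ _ (k.*2 + p).+2).
- by apply: eq_bigr => t _; rewrite (@LE (k.*2 + p)) mxE.
- by rewrite /= size_rcons size_bits.
- by clear -kn; lia.
- by rewrite /row_length kn; clear; lia.
- by clear -kn; lia.
Qed.

Lemma middle_colS j : (j < q)%N -> middle_col j = C (n.*2 + p) *m middle_col j.+1.
Proof.
move=> jq; apply/matrixP => i j'; rewrite mxE [RHS]mxE.
rewrite (@ext_rows_from _ _ (n.*2 + p)).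
- by apply: eq_bigr => t _; rewrite CE mxE addnS.
- by rewrite size_bits.
- by clear -jq; lia.
- by rewrite /row_length; clear -jq; case: ifP; [|case: ifP]; lia.
- by clear; lia.
Qed.

Lemma mem_rows_from_upper k x :
    (k <= n)%N -> x \in rows_from (n.*2 + q - k) ->
    x.2 = (n.*2 + q - k)%N :> nat ->
  (n - k <= x.1 < n - k + (k.*2 + p))%N.
Proof.
move=> kn; rewrite mem_rows_from => /andP[xA _] xr.
have := ltn_ord x.2; rewrite [nat_of_ord _]xr => rH.
rewrite -(@mem_aztec _ (k.*2 + p)) // ?xr; last by clear -kn; lia.
by rewrite /row_length; clear -kn rH; case: ifP; [|case: ifP]; lia.
Qed.

(** The row exceeds its upper boundary on both sides, so only states [false :: rcons t false]
    contribute; [transC] then gives the transpose. *)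
Lemma upper_colS k :
  (k < n)%N -> upper_col k.+1 = (L (k.+1.*2 + p))^T *m upper_col k.
Proof.
move=> kn; apply/matrixP => i j; rewrite mxE [RHS]mxE.
have rS : (n.*2 + q - k.+1).+1 = (n.*2 + q - k)%N by clear -kn; lia.
have cS : (n - k.+1).+1 = (n - k)%N by apply: subnSK.
rewrite (@ext_rows_from _ _ (k.*2 + p).+2); first last.
- by clear -kn; lia.
- by rewrite /row_length; clear -kn; case: ifP; [|case: ifP]; lia.
- by clear -kn; lia.
- by rewrite size_bits.
(* A leading bit [true] would mark a cell left of the next row; the trailing bit is treated likewise
   below. *)
rewrite rS big_pow2S [Z in (_ + Z)%N]big1 ?addn0.
  pose F t := (trans (bits i) (false :: t) *
    ext (rows_from (n.*2 + q - k)) (n - k) (n.*2 + q - k) t)%N.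
  transitivity (\sum_(t < pow2 (k.*2 + p).+1) F (bits t))%N.
    by apply: eq_bigr => t _; rewrite bits_lshift /F -cS.
  rewrite big_bits_rcons.
    apply: eq_bigr => t _; rewrite /F ext_rcons_false mxE.
    by rewrite (@LE (k.*2 + p)) mxE transC.
  move=> s sk; rewrite /F ext_rcons_true ?muln0 // => x xX.
  apply/negP => /andP[/eqP x1 /eqP x2].
  have /andP[_] := mem_rows_from_upper (ltnW kn) xX x2.
  by rewrite [nat_of_ord _]x1 sk ltnn.
move=> t _; rewrite bits_rshift /= [Z in (_ * Z)%N]big1 ?muln0 // => x /andP[xX].
case/andP=> /eqP x1 /eqP x2.
have /andP[+ _] := mem_rows_from_upper (ltnW kn) xX x2.
by rewrite [nat_of_ord _]x1 -cS ltnn.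
Qed.

(** * Products of transfer matrices *)

Lemma lower_col_prod k : (k <= n)%N -> lower_col 0 = L_prod p k *m lower_col k.
Proof.
elim: k => [|k IHk] kn; first by rewrite mul1mx.
by rewrite (IHk (ltnW kn)) (lower_colS kn) mulmxA.
Qed.

Lemma middle_col_prod j :
  (j <= q)%N -> middle_col 0 = C (n.*2 + p) ^+ j *m middle_col j.
Proof.
elim: j => [|j IHj] jq; first by rewrite expr0 mul1mx.
by rewrite (IHj (ltnW jq)) (middle_colS jq) mulmxA exprSr.
Qed.

Lemma upper_col_prod k :
  (k <= n)%N -> upper_col k = (L_prod p k)^T *m upper_col 0.
Proof.
elim: k => [|k IHk] kn; first by rewrite trmx1 mul1mx.
by rewrite (upper_colS kn) (IHk (ltnW kn)) mulmxA -trmx_mul.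
Qed.

Lemma lower_middle_col : lower_col n = middle_col 0.
Proof. by apply/matrixP => i j; rewrite !mxE subnn addn0. Qed.

Lemma middle_upper_col : middle_col q = upper_col n.
Proof.
apply/matrixP => i j; rewrite !mxE subnn.
have -> // : (n.*2 + q - n = n + q)%N by rewrite -addnn -addnA addKn.
Qed.

Lemma alpha_lower_col : alpha p q n = lower_col 0 (idx1 p) ord0.
Proof.
rewrite mxE bits_idx1 ext_nseq_false; congr #|pred_of_set (tilings _ _)|.
by apply/setP => x; rewrite mem_rows_from andbT.
Qed.

(** Nothing lies above the top boundary, so only the state without crossings is possible, with the
    empty tiling. *)
Lemma upper_col0 i j : upper_col 0 i j = (i == idx1 p).
Proof.
rewrite mxE subn0.
have -> : rows_from (n.*2 + q) = set0.
  by apply/setP => x; rewrite mem_rows_from leqNgt ltn_ord andbF inE.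
by rewrite ext_set0 has_bits negbK.
Qed.

End Geometry.

Theorem theorem1 (p q n : nat) :
  alpha p q n =
  (L_prod p n *m C (n.*2 + p) ^+ q *m (L_prod p n)^T) (idx1 p) (idx1 p).
Proof.
rewrite (alpha_lower_col p q n) (lower_col_prod p q (leqnn n)) lower_middle_col.
rewrite (middle_col_prod p n (leqnn q)) middle_upper_col.
(* [upper_col 0] is the first unit vector, so it selects the first column of the product. *)
rewrite (upper_col_prod p q (leqnn n)) !mulmxA mxE (bigD1 (idx1 p)) //=.
rewrite upper_col0 eqxx mulr1 big1 ?addr0 // => i /negbTE i1.
by rewrite upper_col0 i1 mulr0.
Qed.
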